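(* If $\alpha$ is a countably infinite order type (of a chain), then the join-semilattice $P_{\alpha}$ is minimal in $\mathbb{J}_{\alpha}$.
   Context: $\mathbb{J}$ is the class of join-semilattices having a least element. An ideal of a poset $P$ is a non-empty up-directed initial segment (down-closed subset); $J(P)$ is the set of ideals of $P$ ordered by inclusion. $I(\alpha)$ is the order type of the chain of all initial segments (including the empty one and the whole chain), ordered by inclusion, of a chain of type $\alpha$. $\mathbb{J}_{\alpha}$ is the class of $P\in\mathbb{J}$ such that $J(P)$ contains a chain of type $I(\alpha)$. $\mathbb{J}$ is quasi-ordered by: $P\leq P'$ if $P$ is isomorphic to a join-subsemilattice of $P'$ (a subset closed under binary joins, with the induced order). ''$M$ is minimal in $\mathbb{J}_\alpha$'' means: $M\in\mathbb{J}_\alpha$, and for every $P\in\mathbb{J}_\alpha$ with $P\leq M$ one has $M\leq P$. Lattice sierpinskisations. Let $\gamma$ be a non-zero countable order type and $(A,\leq)$ a chain of type $\gamma$. Let $\mathcal{S}_{Lat}(\gamma)$ be the collection of subsets $S\subseteq\mathbb{N}\times A$, with the order induced by the direct product order of $\mathbb{N}\times A$, such that: (1) for every $n\in\mathbb{N}$, $\{a\in A:(n,a)\in S\}$ is non-empty and finite; (2) for every $a\in A$, $\{n\in\mathbb{N}:(n,a)\in S\}$ is infinite; (3) $S$ is a join-subsemilattice of $\mathbb{N}\times A$. All members of $\mathcal{S}_{Lat}(\gamma)$ embed in each other as join-semilattices. $\Omega(\gamma)$ denotes an arbitrary member of $\mathcal{S}_{Lat}(\gamma)$, and $\underline{\Omega}(\gamma)$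 the join-semilattice obtained from it by adding a least element if it has none. Definition of $P_\alpha$ for a countably infinite order type $\alpha$. Two order types are equimorphic if each embeds in the other; $+$ denotes ordinal (linear) sum. - If $\alpha$ does not embed in any of its proper final segments (equivalently $1+\alpha\not\leq\alpha$), then $\alpha=n+\alpha'$ with $n<\omega$ and $\alpha'$ without a first element, and $P_{\alpha}:=n+\underline{\Omega}(\alpha')$. - Otherwise, if $\alpha$ is equimorphic to $\omega+\alpha'$ for some $\alpha'$, then $P_{\alpha}:=\underline{\Omega}(1+\alpha')$. - Otherwise $P_{\alpha}:=\underline{\Omega}(\alpha)$. *)

(* Defs.v *)
From HB Require Import structures.
From mathcomp Require Import all_boot all_order.
From mathcomp Require Import boolp classical_sets functions cardinality.

Set Implicit Arguments.
Unset Strict Implicit.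
Unset Printing Implicit Defensive.
Set Warnings "-redundant-canonical-projection -projection-no-head-constant".

Import Order.Theory.

Local Open Scope classical_set_scope.
Local Open Scope order_scope.

Definition embeds d d' (X : porderType d) (Y : porderType d') : Prop :=
  exists f : X -> Y, {mono f : x y / x <= y}.

Definition isomorphic d d' (X : porderType d) (Y : porderType d') : Prop :=
  exists2 f : X -> Y, bijective f & {mono f : x y / x <= y}.

Definition equimorphic d d' (X : porderType d) (Y : porderType d') : Prop :=
  embeds X Y /\ embeds Y X.

Definition is_least d (X : porderType d) (m : X) : Prop := forall x, m <= x.

(* A subset, as a poset for the induced order. *)
Definition subposet d (X : porderType d) (S : set X) : Type := set_type S.

HB.instance Definition _ d (X : porderType d) (S : set X) :=
  SubChoice.on (subposet S).
HB.instance Definition _ d (X : porderType d) (S : set X) :=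
  [SubChoice_isSubPOrder of subposet S by <: with d].

Definition to_subposet d (X : porderType d) (S : set X) (x : X) (Sx : S x) :
    subposet S :=
  exist (fun z => z \in S) x (mem_set Sx).

Definition initial_segment d (X : porderType d) : set (set X) :=
  [set I | forall x y, x <= y -> I y -> I x].

Definition final_segment d (X : porderType d) : set (set X) :=
  [set F | forall x y, x <= y -> F x -> F y].

Definition ideal d (P : porderType d) : set (set P) :=
  [set I | [/\ initial_segment I, I !=set0 &
     forall x y, I x -> I y -> exists z, [/\ I z, x <= z & y <= z]]].

Record join_subset d (L : joinSemilatticeType d) := JoinSubset {
  join_carrier :> set L;
  join_carrierP : forall x y, join_carrier x -> join_carrier y ->
    join_carrier (Order.join x y) }.

Section SubposetJoin.
Context d (L : joinSemilatticeType d) (S : join_subset L).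

Definition subposet_join (x y : subposet S) : subposet S :=
  to_subposet (join_carrierP (set_mem (valP x)) (set_mem (valP y))).

Fact subposet_leUx (x y z : subposet S) :
  (subposet_join x y <= z) = (x <= z) && (y <= z).
Proof. by rewrite -!Order.le_val leUx. Qed.

HB.instance Definition _ :=
  Order.POrder_isJoinSemilattice.Build d (subposet S) subposet_leUx.

End SubposetJoin.

(* The ordinal sum: every element of X lies below every element of Y. *)
Definition osum (X Y : Type) : Type := (X + Y)%type.

HB.instance Definition _ (X Y : choiceType) := Choice.on (osum X Y).

Definition osum_le d d' (X : porderType d) (Y : porderType d')
    (u v : osum X Y) : bool :=
  match u, v with
  | inl x, inl x' => x <= x'
  | inl _, inr _ => true
  | inr _, inl _ => false
  | inr y, inr y' => y <= y'
  end.

Section OsumPOrder.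
Context d d' (X : porderType d) (Y : porderType d').

Fact osum_le_refl : reflexive (@osum_le _ _ X Y).
Proof. by case=> x /=. Qed.

Fact osum_le_anti : antisymmetric (@osum_le _ _ X Y).
Proof. by move=> [x|x] [y|y] //= /le_anti ->. Qed.

Fact osum_le_trans : transitive (@osum_le _ _ X Y).
Proof. by move=> [y|y] [x|x] [z|z] //=; apply: le_trans. Qed.

HB.instance Definition _ := Order.Le_isPOrder.Build d' (osum X Y)
  osum_le_refl osum_le_anti osum_le_trans.

End OsumPOrder.

Section OsumJoin.
Context d d' (X : joinSemilatticeType d) (Y : joinSemilatticeType d').

Definition osum_join (u v : osum X Y) : osum X Y :=
  match u, v with
  | inl x, inl x' => inl (Order.join x x')
  | inl _, inr y => inr y
  | inr y, inl _ => inr y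
  | inr y, inr y' => inr (Order.join y y')
  end.

Fact osum_leUx (u v w : osum X Y) : (osum_join u v <= w) = (u <= w) && (v <= w).
Proof.
case: u v w => [x|x] [y|y] [z|z]; rewrite /Order.le /= ?leUx ?andbT ?andbF //.
Qed.

HB.instance Definition _ :=
  Order.POrder_isJoinSemilattice.Build d' (osum X Y) osum_leUx.

End OsumJoin.

Section OsumMeet.
Context d d' (X : meetSemilatticeType d) (Y : meetSemilatticeType d').

Definition osum_meet (u v : osum X Y) : osum X Y :=
  match u, v with
  | inl x, inl x' => inl (Order.meet x x')
  | inl x, inr _ => inl x
  | inr _, inl x => inl x
  | inr y, inr y' => inr (Order.meet y y')
  end.

Fact osum_lexI (u v w : osum X Y) : (u <= osum_meet v w) = (u <= v) && (u <= w).
Proof.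
case: u v w => [x|x] [y|y] [z|z]; rewrite /Order.le /= ?lexI ?andbT ?andbF //.
Qed.

HB.instance Definition _ :=
  Order.POrder_isMeetSemilattice.Build d' (osum X Y) osum_lexI.

End OsumMeet.

Section OsumTotal.
Context d d' (X : orderType d) (Y : orderType d').

Fact osum_le_total : total (<=%O : rel (osum X Y)).
Proof. by move=> [x|x] [y|y] //; apply: le_total. Qed.

HB.instance Definition _ :=
  Order.Lattice_isTotal.Build d' (osum X Y) osum_le_total.

End OsumTotal.

Section OsumOrdBottom.
Context (n : nat) d (Y : bJoinSemilatticeType d).

Definition osum_ord_bottom : osum 'I_n Y :=
  if insub 0 is Some i then inl i else inr Order.bottom.

Fact osum_ord_le0x (u : osum 'I_n Y) : osum_ord_bottom <= u.
Proof.
rewrite /osum_ord_bottom; case: insubP => [i _ i0|].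
  by case: u => [j|y]; rewrite /Order.le //= leEord i0.
case: u => [[j jn]|y]; last by rewrite /Order.le /= le0x.
by rewrite (leq_ltn_trans _ jn).
Qed.

HB.instance Definition _ :=
  Order.hasBottom.Build d (osum 'I_n Y) osum_ord_le0x.

End OsumOrdBottom.

(* L with a new least element if it has none: the part of 1 + L from which the
   element of 1 is removed when L has a least element. *)
Section AddBottom.
Context d (L : joinSemilatticeType d).

Definition add_bottom_set : set (osum 'I_1 L) :=
  [set u | (exists m : L, is_least m) -> exists x : L, u = inr x].

Fact add_bottom_setP (u v : osum 'I_1 L) : add_bottom_set u ->
  add_bottom_set v -> add_bottom_set (Order.join u v).
Proof.
by move=> hu hv hL; have [x ->] := hu hL; have [y ->] := hv hL; eexists.
Qed.

Definition add_bottom : Type := subposet (JoinSubset add_bottom_setP).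

HB.instance Definition _ := Order.JoinSemilattice.on add_bottom.

Fact add_bottom_least : {m : add_bottom | is_least m}.
Proof.
apply: cid; have [[m mP]|nL] := pselect (exists m : L, is_least m).
  have hm : add_bottom_set (inr m) by exists m.
  exists (to_subposet hm) => u; rewrite -Order.le_val /=.
  have [x ->] := set_mem (valP u) (ex_intro _ m mP); exact: mP.
have h0 : add_bottom_set (inl ord0) by [].
exists (to_subposet h0) => u; rewrite -Order.le_val /=.
by case: (val u) => [i|x]; rewrite /Order.le //= leEord.
Qed.

HB.instance Definition _ :=
  Order.hasBottom.Build d add_bottom (svalP add_bottom_least).

End AddBottom.

(* Membership of a join-subsemilattice S of the product nat x A in S_Lat(A).
   These conditions force A to be non-empty and countable. *)
Definition lattice_sierpinskisation d (A : orderType d)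
    (S : join_subset (nat *p A)%type) : Prop :=
  (forall n : nat, [set a | join_carrier S (n, a)] !=set0 /\
     finite_set [set a | join_carrier S (n, a)]) /\
  (forall a : A, infinite_set [set n | join_carrier S (n, a)]).

Definition embeds_in_proper_final_segment d (A : orderType d) : Prop :=
  exists F : set A, [/\ final_segment F, F != setT & embeds A (subposet F)].

Definition starts_with_omega d d' (A : orderType d) (A' : orderType d') : Prop :=
  equimorphic A (osum nat A').

(* [P_alpha A M] says that M is one of the join-semilattices P_alpha, alpha
   being the type of A; the definition leaves open the choice of alpha' and of
   the lattice sierpinskisation. *)
Inductive P_alpha d (A : orderType d) :
    forall d', bJoinSemilatticeType d' -> Prop :=
| P_alpha_sum n d' (A' : orderType d') (S : join_subset (nat *p A')%type) :
    ~ embeds_in_proper_final_segment A ->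
    isomorphic A (osum 'I_n A') ->
    ~ (exists a : A', is_least a) ->
    lattice_sierpinskisation S ->
    P_alpha A (osum 'I_n (add_bottom (subposet S)))
| P_alpha_omega d' (A' : orderType d')
    (S : join_subset (nat *p osum 'I_1 A')%type) :
    embeds_in_proper_final_segment A ->
    starts_with_omega A A' ->
    lattice_sierpinskisation S ->
    P_alpha A (add_bottom (subposet S))
| P_alpha_self (S : join_subset (nat *p A)%type) :
    embeds_in_proper_final_segment A ->
    (forall d' (A' : orderType d'), ~ starts_with_omega A A') ->
    lattice_sierpinskisation S ->
    P_alpha A (add_bottom (subposet S)).

(* The membership of P in J_alpha: J(P) contains a chain of type I(alpha). *)
Definition in_J d d' (A : orderType d) (P : bJoinSemilatticeType d') : Prop :=
  embeds (subposet (@initial_segment _ A)) (subposet (@ideal _ P)).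

(* The joins are preserved, the least element need not be. *)
Definition join_le d d' (P : joinSemilatticeType d) (P' : joinSemilatticeType d')
    : Prop :=
  exists S : join_subset P', isomorphic P (subposet S).

Definition minimal_in_J d d' (A : orderType d) (M : bJoinSemilatticeType d')
    : Prop :=
  in_J A M /\
  forall d'' (P : bJoinSemilatticeType d''),
    in_J A P -> join_le P M -> join_le M P.

(* Main.v *)
From HB Require Import structures.
Require Import Defs.
From mathcomp Require Import all_boot all_order finmap.
From mathcomp Require Import boolp classical_sets functions cardinality.

(** Forget the least element: up to a finite chain put at the bottom, both P and
   P_alpha sit inside a product nat x G with finite rows [{n} x G].  There an
   infinite ideal is unbounded in the direction of nat, hence is determined by
   the initial segment of G onto which it projects.

   A chain Phi of ideals of P of type I(alpha) sends infinite initial segments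
   to infinite ideals.  Choose r(a) in Phi(<= a) but not in Phi(< a): the
   G-component of r(a) is strictly increasing on the a with Phi(< a) infinite.
   If the infinite ideal K lies below the ideals Phi(< c), c in a finite row m of
   S, an element q_m of K with large nat-component gives
   (m, c) |-> q_m \/ r(c), and if the q_m have increasing nat-components this is
   a join-embedding of S into P.

   For [P_alpha_sum], alpha = n + alpha', the elements of alpha' have infinitely
   many predecessors, so K is Phi(< b) for a lower bound b of the row; the n + 1
   elements below come from the finite initial segments.  For [P_alpha_omega],
   K = Phi(omega), and the column of the first element of 1 + alpha' is sent to
   the q_m themselves, taken increasing.  For [P_alpha_self], iterate an
   embedding h of A with y < h(a) for all a: either some Phi(< h^k(y)) is
   infinite and serves as K after composing with h^(k+1), or the h^k(y) generate
   an initial segment of type omega, which is excluded. *)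

Set Implicit Arguments.
Unset Strict Implicit.
Unset Printing Implicit Defensive.

Import Order.Theory.

Local Open Scope classical_set_scope.
Local Open Scope order_scope.

(** * Dependent choice and finite sets *)

Lemma dependent_choice (T : Type) (R : nat -> T -> T -> Prop) (x0 : T) :
  (forall n x, exists y, R n x y) ->
  exists q : nat -> T, q 0%N = x0 /\ forall n, R n (q n) (q n.+1).
Proof.
move=> RP; have [s sP] := choice (fun nx : nat * T => RP nx.1 nx.2).
pose q := fix q n := if n is m.+1 then s (m, q m) else x0.
by exists q; split=> // n; apply: (sP (n, q n)).
Qed.

Lemma infinite_set_nat_gt (X : set nat) (k : nat) :
  infinite_set X -> exists2 n, X n & (k < n)%N.
Proof.
move=> Xinf; apply: contrapT => nX; apply: Xinf.
apply: (@sub_finite_set _ _ `I_k.+1); last exact: finite_II.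
move=> n Xn /=; rewrite ltnS leqNgt.
by apply/negP => kn; apply: nX; exists n.
Qed.

Lemma finite_set_leq (T : Type) (X : set T) (h : T -> nat) :
  finite_set X -> exists k, forall x, X x -> (h x <= k)%N.
Proof.
move=> /(finite_image h) Xfin; apply: contrapT => nk.
have hX : infinite_set [set n | ~ forall x, X x -> (h x <= n)%N].
  apply: (@sub_infinite_set _ setT); last exact: infinite_nat.
  by move=> n _ hn; apply: nk; exists n.
have /finite_seqP[s hs] := Xfin.
apply: nk; exists (sumn s) => x Xx.
have : [set` s] (h x) by rewrite -hs; exists x.
move=> /= hxs; rewrite (perm_sumn (perm_to_rem hxs)) /=.
exact: leq_addr.
Qed.

Lemma finite_set_lower_bound d (T : orderType d) (X : set T) (x0 : T) :
  finite_set X -> exists b, forall x, X x -> b <= x.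
Proof.
move=> /finite_seqP[s ->]; elim: s => [|y s [b bP]]; first by exists x0.
exists (Order.min y b) => x /=; rewrite inE => /orP[/eqP ->|xs].
  by rewrite ge_min lexx.
by rewrite ge_min (bP _ xs) orbT.
Qed.

(** * Join-embeddings *)

Section JoinEmbeddings.

Definition join_embeds d d' (X : joinSemilatticeType d)
    (Y : joinSemilatticeType d') : Prop :=
  exists2 f : X -> Y, {mono f : x y / x <= y} &
    {morph f : x y / Order.join x y}.

Lemma join_embeds_trans d1 d2 d3 (X : joinSemilatticeType d1)
    (Y : joinSemilatticeType d2) (Z : joinSemilatticeType d3) :
  join_embeds X Y -> join_embeds Y Z -> join_embeds X Z.
Proof.
move=> [f fm fj] [g gm gj]; exists (g \o f) => x y /=.
  by rewrite gm fm.
by rewrite fj gj.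
Qed.

Lemma val_join d (L : joinSemilatticeType d) (S : join_subset L)
    (x y : subposet S) :
  val (Order.join x y) = Order.join (val x) (val y).
Proof. by []. Qed.

Lemma join_embeds_sub d (L : joinSemilatticeType d) (S : join_subset L) :
  join_embeds (subposet S) L.
Proof. by exists val => x y. Qed.

(** An order isomorphism onto a join-subset carries joins along because they are least upper bounds;
    conversely, the range of a join-embedding is closed under joins. *)
Lemma join_leP d d' (X : joinSemilatticeType d) (Y : joinSemilatticeType d') :
  join_le X Y <-> join_embeds X Y.
Proof.
split=> [[S [f [g fK gK] fm]]|[f fm fj]].
  apply: join_embeds_trans (join_embeds_sub S); exists f.
    exact: fm.
  move=> x y.
  apply/le_anti/andP; split; last by rewrite leUx !fm leUl leUr.
  rewrite -[X in _ <= X]gK fm leUx -!fm !gK leUl; exact: leUr.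
have hS x y : range f x -> range f y -> range f (Order.join x y).
  by move=> [u _ <-] [v _ <-]; exists (Order.join u v).
have hf x : range f (f x) by exists x.
exists (JoinSubset hS); exists (fun x => to_subposet (hf x)); last first.
  by move=> x y; rewrite -Order.le_val /= fm.
have fi : injective f by move=> x y e; apply/le_anti; rewrite -!fm e lexx.
have /choice[g gP] : forall u : subposet (JoinSubset hS), exists x, f x = val u.
  by move=> u; have [x _ xu] := set_mem (valP u); exists x.
by exists g => [x|u]; [apply: fi|apply: val_inj]; rewrite /= gP.
Qed.

End JoinEmbeddings.

(** * Chains of ideals *)

Lemma in_JP d d' (A : orderType d) (P : bJoinSemilatticeType d') :
  in_J A P <-> exists Phi : set A -> set P,
    (forall I, initial_segment I -> ideal (Phi I)) /\
    (forall I I', initial_segment I -> initial_segment I' ->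
       (Phi I `<=` Phi I') <-> (I `<=` I')).
Proof.
split=> [[F Fm]|[Phi [PhiI Phim]]].
  (* [Phi] takes the default value [set0] outside the initial segments, where nothing is asked of
     it. *)
  exists (fun I => if pselect (initial_segment I) is left h
                   then val (F (to_subposet h)) else set0); split.
    by move=> I hI; case: pselect => // h; apply: set_mem (valP _).
  move=> I I' hI hI'; case: pselect => // h; case: pselect => // h'.
  by rewrite -!subsetEset [X in is_true X <-> _]Order.le_val Fm -Order.le_val.
exists (fun I => to_subposet (PhiI _ (set_mem (valP I)))) => I I'.
rewrite -!Order.le_val /=; apply/idP/idP; rewrite !subsetEset.
  by move/Phim; apply; apply: set_mem (valP _).
by move=> ?; apply/Phim => //; apply: set_mem (valP _).
Qed.

(** Taking the down-closure [D I] of the image of [I] turns an embedding of chains into one of their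
    chains of initial segments. *)
Lemma in_J_embeds d d' d'' (A : orderType d) (B : orderType d')
    (P : bJoinSemilatticeType d'') : embeds B A -> in_J A P -> in_J B P.
Proof.
move=> [f fm] /in_JP[Phi [PhiI Phim]]; apply/in_JP.
pose D (I : set B) := [set a | exists2 b, I b & a <= f b].
have DI I : initial_segment I -> initial_segment (D I).
  by move=> hI x y xy [b Ib yb]; exists b => //; apply: le_trans yb.
exists (Phi \o D); split=> [I hI|I I' hI hI']; first exact/PhiI/DI.
rewrite /= Phim; [|exact: DI..]; split=> II'.
  move=> b Ib; have [|b' Ib'] := II' (f b); first by exists b.
  by rewrite fm => /hI'; apply.
by move=> a [b /II' Ib ab]; exists b.
Qed.

(** The down-closures of the sets [G I] are the ideals. To tell two of them apart one needs a point
    of [G I] below no element of [G I'], whence the last hypothesis. *)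
Lemma in_J_directed d d' (A : orderType d) (P : bJoinSemilatticeType d')
    (G : set A -> set P) :
  (forall I, initial_segment I -> G I !=set0) ->
  (forall I, initial_segment I -> forall x y, G I x -> G I y ->
     G I (Order.join x y)) ->
  (forall I I', I `<=` I' -> G I `<=` G I') ->
  (forall I I' a, initial_segment I -> initial_segment I' ->
     I a -> ~ I' a -> exists2 x, G I x & forall y, G I' y -> ~~ (x <= y)) ->
  in_J A P.
Proof.
move=> G0 GU Gm Gs; apply/in_JP.
exists (fun I => [set x | exists2 y, G I y & x <= y]); split.
  move=> I hI; split.
  - by move=> x y xy [z Gz yz]; exists z => //; apply: le_trans yz.
  - by have [x Gx] := G0 I hI; exists x; exists x.
  - move=> x y [x' Gx xx'] [y' Gy yy']; exists (Order.join x' y').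
    split; first by exists (Order.join x' y') => //; apply: GU.
      by apply: le_trans xx' _; apply: leUl.
    by apply: le_trans yy' _; apply: leUr.
move=> I I' hI hI'; split=> II'; last first.
  by move=> x [y /(Gm _ _ II') Gy xy]; exists y.
move=> a Ia; apply: contrapT => nI'a.
have [x Gx xP] := Gs _ _ _ hI hI' Ia nI'a.
have [|y Gy xy] := II' x; first by exists x.
by have := xP y Gy; rewrite xy.
Qed.

(** * Chains of ideals in lattice sierpinskisations *)

Section AddBottomTheory.
Context d (L : joinSemilatticeType d).

Lemma add_bottom_set_inr (x : L) : add_bottom_set (inr x).
Proof. by exists x. Qed.

Definition add_bottom_inr (x : L) : add_bottom L :=
  to_subposet (add_bottom_set_inr x).

Lemma add_bottom_inr_le x y : (add_bottom_inr x <= add_bottom_inr y) = (x <= y).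
Proof. by []. Qed.

Lemma add_bottom_inr_join x y :
  Order.join (add_bottom_inr x) (add_bottom_inr y) =
  add_bottom_inr (Order.join x y).
Proof. exact: val_inj. Qed.

End AddBottomTheory.

Section Sierpinskisation.
Context d (A : orderType d) (S : join_subset (nat *p A)%type).
Hypothesis SP : lattice_sierpinskisation S.

Lemma sierpinskisation_column (a : A) (k : nat) :
  exists2 s : subposet S, (val s).2 = a & (k < (val s).1)%N.
Proof.
have [n Sn kn] := infinite_set_nat_gt k (SP.2 a).
by exists (to_subposet (Sn : join_carrier S (n, a))).
Qed.

(** The least element of [add_bottom] may be a point of [S]; going further up the column avoids
    it. *)
Lemma sierpinskisation_column_neq0 (a : A) :
  exists2 s : subposet S, (val s).2 = a & add_bottom_inr s <> Order.bottom.
Proof.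
have [s sa _] := sierpinskisation_column a 0.
have [t ta st] := sierpinskisation_column a (val s).1.
exists t => // t0; have := le0x (add_bottom_inr s).
rewrite -t0 add_bottom_inr_le -Order.le_val leEprod => /andP[+ _].
by rewrite leEnat leqNgt st.
Qed.

End Sierpinskisation.

Lemma in_J_osum n d (A : orderType d) (S : join_subset (nat *p A)%type) :
  lattice_sierpinskisation S ->
  in_J (osum 'I_n A) (osum 'I_n (add_bottom (subposet S))).
Proof.
(* Off by one: [inl i] enters as soon as all [j < i] are in [I], and the bottom of the second
   summand acts as index [n]. Thus [G set0] is non-empty, and the [n + 1] initial segments of ['I_n]
   are told apart. *)
move=> SP; pose G (I : set (osum 'I_n A)) :=
  [set u : osum 'I_n (add_bottom (subposet S)) | match u with
   | inl i => forall j : 'I_n, (j < i)%N -> I (inl j)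
   | inr v => (forall j : 'I_n, I (inl j)) /\
       (v = Order.bottom \/
        exists s, v = add_bottom_inr s /\ I (inr (val s).2))
   end].
apply: (@in_J_directed _ _ _ _ G).
- move=> I _; case: n I @G => [|n] I G; last by exists (inl ord0).
  by exists (inr Order.bottom); split; [case|left].
- move=> I hI [i|x] [j|y] //=.
  + by move=> hi hj; rewrite joinEtotal; case: leP.
  + move=> [hx +] [_ +]; case=> [->|[s [-> Is]]]; case=> [->|[t [-> It]]].
    * by split=> //; left; rewrite joinxx.
    * by split=> //; right; exists t; rewrite join0x.
    * by split=> //; right; exists s; rewrite joinx0.
    * split=> //; right; exists (Order.join s t); rewrite add_bottom_inr_join.
      split=> //; rewrite val_join joinEprod /= joinEtotal.
      by case: leP.
- move=> I I' II' [i hi j ji|v [hI [v0|[s [vs Is]]]]]; first exact/II'/hi.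
    by split; [move=> j; apply/II'|left].
  by split; [move=> j; apply/II'|right; exists s; split=> //; apply: II'].
- move=> I I' a hI hI' Ia I'a; case: a Ia I'a => [j|c] Ia I'a.
    have Ij (i : 'I_n) : (i <= j)%N -> I (inl i) by move=> ij; apply: hI Ia.
    (* The witness for [j] is the next element: [j + 1], or the bottom when [j] is the last
       index. *)
    have [jn|nj] := ltnP j.+1 n.
      exists (inl (Ordinal jn)) => [i /=|[i hi|v [hv _]]].
      + by rewrite ltnS => /Ij.
      + by apply/negP => ji; apply: I'a; apply: hi.
      + by case: (I'a (hv j)).
    exists (inr Order.bottom : osum 'I_n (add_bottom (subposet S))).
      split; last by left.
      by move=> i; apply: Ij; rewrite -ltnS (leq_trans _ nj).
    move=> [i _ //|v [hv _]].
    by case: (I'a (hv j)).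
  have [s sc s0] := sierpinskisation_column_neq0 SP c.
  exists (inr (add_bottom_inr s)).
    split; last by right; exists s; rewrite sc.
    by move=> j; apply: hI Ia.
  move=> [//|v [_ hv]]; apply/negP => sv.
  have {}sv : add_bottom_inr s <= v := sv.
  case: hv => [v0|[t [vt I't]]].
    by apply: s0; apply/le_anti; rewrite le0x andbT -v0.
  move: sv; rewrite vt add_bottom_inr_le -Order.le_val leEprod => /andP[_].
  by rewrite sc => ct; apply: I'a; apply: hI' I't.
Qed.

Lemma embeds_osum0 d (X : porderType d) :
  embeds X (osum 'I_0 X) /\ embeds (osum 'I_0 X) X.
Proof.
split; first by exists inr.
exists (fun u : osum 'I_0 X => match u with
        | inl i => False_rect X (notF (ltn_ord i)) | inr x => x end).
by move=> [[]//|x] [[]//|y].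
Qed.

Lemma in_J_sub d d' d'' (A : orderType d) (P : bJoinSemilatticeType d')
    (Q : bJoinSemilatticeType d'') : embeds P Q -> in_J A P -> in_J A Q.
Proof.
move=> [f fm] /in_JP[Phi [PhiI Phim]]; apply/in_JP.
exists (fun I => [set y | exists2 x, Phi I x & y <= f x]); split.
  move=> I /PhiI[Id [x0 Ix0] Iu]; split.
  - by move=> x y xy [z Iz yz]; exists z => //; apply: le_trans yz.
  - by exists (f x0), x0.
  - move=> x y [x' Ix xx'] [y' Iy yy']; have [z [Iz xz yz]] := Iu _ _ Ix Iy.
    exists (f z); split; first by exists z.
      by apply: le_trans xx' _; rewrite fm.
    by apply: le_trans yy' _; rewrite fm.
move=> I I' hI hI'; rewrite -Phim //; split=> II'.
  move=> x Ix; have [|y I'y] := II' (f x); first by exists x.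
  by rewrite fm; have [+ _ _] := PhiI _ hI' => h /h; apply.
by move=> y [x /II' Ix yx]; exists x.
Qed.

Lemma in_J_add_bottom d (A : orderType d) (S : join_subset (nat *p A)%type) :
  lattice_sierpinskisation S -> in_J A (add_bottom (subposet S)).
Proof.
move=> /(in_J_osum 0); move/(in_J_embeds (embeds_osum0 A).1).
exact: in_J_sub (embeds_osum0 _).2.
Qed.

(* The finite initial segments of [nat] correspond to principal ideals of the
   bottom column of S. *)
Lemma in_J_omega d (A : orderType d)
    (S : join_subset (nat *p osum 'I_1 A)%type) :
  lattice_sierpinskisation S ->
  in_J (osum nat A) (add_bottom (subposet S)).
Proof.
move=> SP.
have [q [q0 qP]] : exists q : nat -> subposet S, (val (q 0%N)).2 = inl ord0 /\
    forall k, (val (q k.+1)).2 = inl ord0 /\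
      ((val (q k)).1 < (val (q k.+1)).1)%N.
  have [s0 s0c _] := sierpinskisation_column SP (inl ord0) 0.
  have [|q [q0 qP]] := @dependent_choice (subposet S)
    (fun _ s t => (val t).2 = inl ord0 /\ ((val s).1 < (val t).1)%N) s0.
    move=> _ s; have [t tc st] :=
      sierpinskisation_column SP (inl ord0) (val s).1.
    by exists t.
  by exists q; rewrite q0.
have q2 k : (val (q k)).2 = inl ord0 by case: k => // k; case: (qP k).
have qlt : {homo (fun k => (val (q k)).1) : k l / (k < l)%N}.
  by apply: homo_ltn (@ltn_trans) _ => k; case: (qP k).
have qle k l : (q k <= q l) = (k <= l)%N.
  rewrite -Order.le_val leEprod !q2 lexx andbT leEnat.
  exact: (leq_mono qlt).
have qj k l : Order.join (q k) (q l) = q (maxn k l).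
  wlog kl : k l / (k <= l)%N => [hw|].
    by by have /orP[/hw|/hw h] := leq_total k l; last rewrite joinC maxnC.
  by rewrite (maxn_idPr kl); apply/join_r; rewrite qle.
(* From the first column only the chain [q] is kept, again shifted by one: [q 0] always belongs, and
   [q k.+1] enters together with [k]. *)
pose G (I : set (osum nat A)) :=
  [set u | exists2 s : subposet S, u = add_bottom_inr s & match (val s).2 with
    | inl _ => exists2 k, s = q k & forall j, (j < k)%N -> I (inl j)
    | inr c => I (inr c) end].
apply: (@in_J_directed _ _ _ _ G).
- move=> I _; exists (add_bottom_inr (q 0%N)), (q 0%N) => //.
  by rewrite q0; exists 0%N.
- move=> I hI _ _ [s -> hs] [t -> ht]; rewrite add_bottom_inr_join.
  exists (Order.join s t) => //; rewrite val_join joinEprod /=.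
  move: hs ht; case Es: (val s).2 => [i|c]; case Et: (val t).2 => [j|e].
  + move=> [k -> hk] [l -> hl]; exists (maxn k l); first exact: qj.
    by move=> m; rewrite leq_max => /orP[/hk|/hl].
  + by [].
  + by [].
  + by move=> Ic Ie /=; rewrite joinEtotal; case: leP.
- move=> I I' II' u [s -> hs]; exists s => //.
  case: (val s).2 hs => [_ [k -> hk]|c /II' //].
  by exists k => // j /hk /II'.
- move=> I I' [k|c] hI hI' Ia I'a.
    exists (add_bottom_inr (q k.+1)).
      exists (q k.+1) => //; rewrite q2; exists k.+1 => // j jk.
      exact: hI Ia.
    move=> _ [s -> +]; rewrite add_bottom_inr_le.
    case: (val s).2 => [_ [l -> hl]|c I'c].
      by rewrite qle; apply/negP => /hl.
    by case: I'a; apply: hI' I'c.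
  have [s sc _] := sierpinskisation_column SP (inr c) 0.
  exists (add_bottom_inr s); first by exists s; rewrite ?sc.
  move=> _ [t -> +]; rewrite add_bottom_inr_le -Order.le_val leEprod sc.
  case: (val t).2 => [i _|e I'e]; rewrite negb_and; apply/orP; right=> //.
  by apply/negP => ce; apply: I'a; apply: hI' I'e.
Qed.

(** * Coordinates in a product with finite rows *)

(** In other words, [x |-> (N x, g x)] is a join-embedding into the product of [nat] and [G] whose
    image has finite rows. *)
Record grid_coordinates d (P : joinSemilatticeType d) d' (G : orderType d')
    (N : P -> nat) (g : P -> G) : Prop := GridCoordinates {
  grid_le : forall x y, (x <= y) = (N x <= N y)%N && (g x <= g y);
  grid_joinN : forall x y, N (Order.join x y) = maxn (N x) (N y);
  grid_joing : forall x y, g (Order.join x y) = Order.max (g x) (g y);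
  grid_finite : forall k, finite_set [set x | (N x <= k)%N] }.

Lemma grid_embeds d1 d2 d' (P : joinSemilatticeType d1)
    (Q : joinSemilatticeType d2) (G : orderType d') (N : Q -> nat) (g : Q -> G)
    (f : P -> Q) :
  {mono f : x y / x <= y} -> {morph f : x y / Order.join x y} ->
  grid_coordinates N g -> grid_coordinates (N \o f) (g \o f).
Proof.
move=> fm fj gP; split=> [x y|x y|x y|k] /=.
- by rewrite -fm (grid_le gP).
- by rewrite fj (grid_joinN gP).
- by rewrite fj (grid_joing gP).
apply: (@finite_preimage _ _ [set y | (N y <= k)%N] f); last first.
  exact: grid_finite gP k.
by move=> x y _ _ e; apply/le_anti; rewrite -!fm e lexx.
Qed.

(** The finite chain goes to row 0, in [n] new columns to the left of those of [G]. *)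
Definition osum_row n d (G : orderType d) (S : join_subset (nat *p G)%type)
    (u : osum 'I_n (subposet S)) : nat :=
  match u with inl _ => 0%N | inr s => (val s).1 end.

Definition osum_column n d (G : orderType d) (S : join_subset (nat *p G)%type)
    (u : osum 'I_n (subposet S)) : osum 'I_n G :=
  match u with inl i => inl i | inr s => inr (val s).2 end.

Lemma grid_osum n d (G : orderType d) (S : join_subset (nat *p G)%type) :
  (forall k, finite_set [set a | join_carrier S (k, a)]) ->
  grid_coordinates (@osum_row n _ G S) (@osum_column n _ G S).
Proof.
move=> Sfin; split=> [[i|s] [j|t]|[i|s] [j|t]|u v|k] //=.
- by rewrite andbF.
- by rewrite max0n.
- by rewrite -joinEtotal; case: u v => [i|s] [j|t].
pose f (u : osum 'I_n (subposet S)) := (osum_row u, osum_column u).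
(* [X i] is a finite set containing the columns that occur in row [i]; the new columns are allowed
   in every row for uniformity. *)
pose X i : set (osum 'I_n G) :=
  range inl `|` inr @` [set a | join_carrier S (i, a)].
apply: (@sub_finite_set _ _
    (f @^-1` \bigcup_(i in `I_k.+1) (pair i @` X i))).
  move=> [i|s] /= sk; [exists 0%N|exists (val s).1] => //.
    by exists (inl i) => //; left; exists i.
  exists (inr (val s).2) => //; right; exists (val s).2 => //=.
  by rewrite -surjective_pairing; apply: set_mem (valP s).
apply: finite_preimage => [[i|s] [j|t] _ _ [] //|].
- by move=> ->.
- by move=> st1 st2; congr inr; apply: val_inj;
  rewrite [LHS]surjective_pairing [RHS]surjective_pairing /= st1 st2.
apply: bigcup_finite => [|i _]; first exact: finite_II.
apply: finite_image; rewrite finite_setU; split; last exact/finite_image/Sfin.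
exact/finite_image/finite_finset.
Qed.

Section Grid.
Context d (P : joinSemilatticeType d) d' (G : orderType d').
Variables (N : P -> nat) (g : P -> G).
Hypothesis gridP : grid_coordinates N g.

Lemma grid_inj x y : N x = N y -> g x = g y -> x = y.
Proof.
by move=> Ne ge; apply/le_anti; rewrite !(grid_le gridP) Ne ge !lexx leqnn.
Qed.

Lemma grid_unbounded (K : set P) (k : nat) :
  infinite_set K -> exists2 x, K x & (k < N x)%N.
Proof.
move=> Kinf; apply: contrapT => nK; apply: Kinf.
apply: sub_finite_set (grid_finite gridP k) => x Kx /=; rewrite leqNgt.
by apply/negP => kx; apply: nK; exists x.
Qed.

(* An infinite ideal is unbounded in the direction of N, so it is determined by
   an initial segment of G. *)
Lemma grid_ideal_lt (J : set P) x y :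
  ideal J -> infinite_set J -> J y -> ~ J x -> g y < g x.
Proof.
move=> [Jd _ Ju] Jinf Jy nJx; rewrite ltNge; apply/negP => xy; apply: nJx.
have [z Jz xz] := grid_unbounded (N x) Jinf.
have [t [Jt yt zt]] := Ju _ _ Jy Jz.
apply: Jd Jt; move: yt zt; rewrite !(grid_le gridP) => /andP[_ yt] /andP[zt _].
by rewrite (leq_trans (ltnW xz) zt) (le_trans xy yt).
Qed.

(** The point [(m, c)] gets the coordinates [(nu m, alpha m c)]. Only in a least column may [alpha]
    vary with [m]: if [c' < c], the join of [(m, c)] and [(m', c')] stays in column [c] but may move
    to row [m'], while its [g] must remain [alpha m c]. *)
Lemma join_embeds_grid n dB (B : orderType dB) (S : join_subset (nat *p B)%type)
    (p : 'I_n.+1 -> P) (f : nat -> B -> P) (nu : nat -> nat)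
    (alpha : nat -> B -> G) :
  {mono p : i j / i <= j} ->
  {homo nu : m m' / (m < m')%N} ->
  (forall m c, join_carrier S (m, c) ->
     N (f m c) = nu m /\ g (f m c) = alpha m c) ->
  (forall i m c, (N (p i) < nu m)%N /\ g (p i) <= alpha m c) ->
  (forall m m' c, (m <= m')%N -> alpha m c <= alpha m' c) ->
  (forall m m' c c', c < c' -> alpha m c < alpha m' c') ->
  (forall m m' c c', c' < c -> alpha m c = alpha m' c) ->
  join_embeds (osum 'I_n.+1 (subposet S)) P.
Proof.
move=> pm nulm fP pf am alt aeq; have nule := leq_mono nulm.
pose phi (u : osum 'I_n.+1 (subposet S)) := match u with
  | inl i => p i | inr s => f (val s).1 (val s).2 end.
have fN (s : subposet S) : N (phi (inr s)) = nu (val s).1.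
  by apply: (fP _ _ _).1; rewrite -surjective_pairing; apply: set_mem (valP s).
have fg (s : subposet S) : g (phi (inr s)) = alpha (val s).1 (val s).2.
  by apply: (fP _ _ _).2; rewrite -surjective_pairing; apply: set_mem (valP s).
have phim : {mono phi : u v / u <= v}.
  move=> [i|s] [j|t].
  - by rewrite /= pm.
  - rewrite (grid_le gridP) fN fg /=.
    by have [ij ->] := pf i (val t).1 (val t).2; rewrite (ltnW ij).
  - rewrite (grid_le gridP) fN fg /=.
    by have [ij _] := pf j (val s).1 (val s).2; rewrite leqNgt ij.
  - rewrite (grid_le gridP) !fN !fg nule [RHS]leEprod leEnat.
    case: leqP => //= st; case: (ltgtP (val s).2 (val t).2) => [lt|lt|->].
    + by rewrite ltW ?alt.
    + by rewrite leNgt alt.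
    + exact: am.
exists phi => // -[i|s] [j|t].
- have /orP[ij|ij] := le_total i j.
    by rewrite (join_r (ij : (inl i : osum 'I_n.+1 (subposet S)) <= inl j))
      (join_r (_ : phi (inl i) <= phi (inl j))) ?phim.
  by rewrite (join_l (ij : (inl j : osum 'I_n.+1 (subposet S)) <= inl i))
    (join_l (_ : phi (inl j) <= phi (inl i))) ?phim.
- by rewrite (join_r (_ : phi (inl i) <= phi (inr t))) ?phim.
- by rewrite (join_l (_ : phi (inl j) <= phi (inr s))) ?phim.
have -> : Order.join (inr s : osum 'I_n.+1 (subposet S)) (inr t) =
  inr (Order.join s t) by [].
apply: grid_inj.
  rewrite (grid_joinN gridP) !fN val_join joinEprod /= joinEtotal maxEnat.
  by case: (leqP (val s).1 (val t).1) => [|/ltnW] st;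
    [rewrite (maxn_idPr _)|rewrite (maxn_idPl _)]; rewrite ?nule.
rewrite (grid_joing gridP) !fg val_join joinEprod /= !joinEtotal maxEnat.
case: (ltgtP (val s).2 (val t).2) => st.
- by rewrite [RHS]max_r ?ltW ?alt //; apply: aeq st.
- by rewrite [RHS]max_l ?ltW ?alt //; apply: aeq st.
rewrite st; case: (leqP (val s).1 (val t).1) => [|/ltnW] e.
  by rewrite [RHS]max_r // am.
by rewrite [RHS]max_l // am.
Qed.

End Grid.

(** * Embedding a sierpinskisation by means of infinite ideals *)

Section Minimality.
Context d (P : bJoinSemilatticeType d) d' (G : orderType d').
Variables (N : P -> nat) (g : P -> G).
Hypothesis gridP : grid_coordinates N g.

(** In the join of [q_m] and [r c], the row comes from [q_m] and the column from [r c]: [q_m] is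
    taken so far up in [K] that its row is at least that of each [r c] along row [m] of [S], and
    since [J c] contains [q_m] but not [r c], [g q_m < g (r c)]. *)
Lemma join_embeds_slabs n dB (B : orderType dB)
    (S : join_subset (nat *p B)%type) (p : 'I_n.+1 -> P)
    (J : B -> set P) (r : B -> P) :
  (forall m, finite_set [set c | join_carrier S (m, c)]) ->
  {mono p : i j / i <= j} ->
  (forall c, ideal (J c)) -> (forall c, infinite_set (J c)) ->
  (forall c, ~ J c (r c)) -> (forall c c', c < c' -> J c' (r c)) ->
  (forall c, J c (p ord_max)) ->
  (forall R : set B, finite_set R ->
     exists2 K, infinite_set K & forall c, R c -> K `<=` J c) ->
  join_embeds (osum 'I_n.+1 (subposet S)) P.
Proof.
move=> Sfin pm Jid Jinf nJr Jr Jp JK.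
(* The sequence starts at the top of the chain [p], and [q m.+1] serves row [m]; so every row lands
   strictly above the rows of all [p i]. *)
have [|q [q0 qP]] := @dependent_choice P (fun m x y => (N x < N y)%N /\
    forall c, join_carrier S (m, c) -> (N (r c) <= N y)%N /\ g y < g (r c))
    (p ord_max).
  move=> m x; have [K Kinf KJ] := JK _ (Sfin m).
  have [k kP] := finite_set_leq (N \o r) (Sfin m).
  have [y Ky] := grid_unbounded gridP (maxn (N x) k) Kinf.
  rewrite gtn_max => /andP[xy ky]; exists y; split=> // c Sc; split.
    exact: leq_trans (kP c Sc) (ltnW ky).
  exact: (grid_ideal_lt gridP (Jid c) (Jinf c) (KJ _ Sc _ Ky)).
have qlt : {homo (fun k => N (q k)) : k l / (k < l)%N}.
  by apply: homo_ltn (@ltn_trans) _ => k; case: (qP k).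
apply: (join_embeds_grid gridP (p := p) (nu := fun m => N (q m.+1))
  (f := fun m c => Order.join (q m.+1) (r c))
  (alpha := fun _ c => g (r c))) => //.
- by move=> m m' mm'; apply: qlt.
- move=> m c Sc; have [_ /(_ c Sc)[rq qr]] := qP m.
  rewrite (grid_joinN gridP) (grid_joing gridP) (maxn_idPl rq).
  by rewrite max_r // ltW.
- move=> i m c; have pi : p i <= q 0%N by rewrite q0 pm leEord -ltnS ltn_ord.
  move: (pi); rewrite (grid_le gridP) => /andP[Npi gpi].
  split; first exact: leq_ltn_trans Npi (qlt 0%N m.+1 isT).
  apply: le_trans gpi _; rewrite q0 ltW //.
  exact: (grid_ideal_lt gridP (Jid c) (Jinf c)).
- move=> _ _ c c' cc'.
  exact: (grid_ideal_lt gridP (Jid c') (Jinf c') (Jr _ _ cc')).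
Qed.

(** The first column has no jump element to join with and is sent to the [q_m] themselves. These
    must then increase in [P] and not just in [N], which the directedness of [K] allows. *)
Lemma join_embeds_staircase dB (B : orderType dB)
    (S : join_subset (nat *p osum 'I_1 B)%type) (K : set P)
    (J : B -> set P) (r : B -> P) :
  (forall m, finite_set [set c | join_carrier S (m, c)]) ->
  (forall c, ideal (J c)) -> (forall c, ~ J c (r c)) ->
  (forall c c', c < c' -> J c' (r c)) ->
  ideal K -> infinite_set K -> (forall c, K `<=` J c) ->
  join_embeds (osum 'I_1 (subposet S)) P.
Proof.
move=> Sfin Jid nJr Jr Kid Kinf KJ.
have Jinf c : infinite_set (J c) by apply: sub_infinite_set Kinf; apply: KJ.
have Kr x c : K x -> g x < g (r c).
  by move=> /KJ Jx; apply: (grid_ideal_lt gridP (Jid c) (Jinf c)).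
have [Kd [p0 Kp0] Ku] := Kid.
(* On the first column [r'] has the dummy value [p0], so that one bound on [N] covers the whole
   row. *)
pose r' (c : osum 'I_1 B) := if c is inr b then r b else p0.
have [|q [q0 qP]] := @dependent_choice {x | K x} (fun m x y =>
    [/\ (N (sval x) < N (sval y))%N, sval x <= sval y &
    forall c, join_carrier S (m, c) -> (N (r' c) <= N (sval y))%N])
    (exist _ p0 Kp0).
  move=> m [x Kx]; have [k kP] := finite_set_leq (N \o r') (Sfin m).
  have [y Ky] := grid_unbounded gridP (maxn (N x) k) Kinf.
  have [z [Kz xz yz]] := Ku _ _ Kx Ky.
  move: (yz); rewrite (grid_le gridP) gtn_max => /andP[Nyz _] /andP[xy ky].
  exists (exist _ z Kz); split=> //=; first exact: leq_trans xy Nyz.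
  move=> c Sc; apply: leq_trans (kP c Sc) _.
  exact: leq_trans (ltnW ky) Nyz.
pose u k := sval (q k); have uK k : K (u k) := svalP (q k).
have ult : {homo (fun k => N (u k)) : k l / (k < l)%N}.
  by apply: homo_ltn (@ltn_trans) _ => k; case: (qP k).
have ule : {homo u : k l / (k <= l)%N >-> k <= l}.
  by apply: homo_leq (@le_refl _ P) (@le_trans _ P) _ => k; case: (qP k).
have gule k l : (k <= l)%N -> g (u k) <= g (u l).
  by move=> /ule; rewrite (grid_le gridP) => /andP[].
pose f m (c : osum 'I_1 B) :=
  if c is inr b then Order.join (u m.+1) (r b) else u m.+1.
pose alpha m (c : osum 'I_1 B) := if c is inr b then g (r b) else g (u m.+1).
apply: (join_embeds_grid gridP (p := fun=> p0) (nu := fun m => N (u m.+1))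
  (f := f) (alpha := alpha)) => //.
- by move=> i j; rewrite !ord1 !lexx.
- by move=> m m' mm'; apply: ult.
- move=> m [i|b] Sc //=; have [_ _ /(_ _ Sc) rq] := qP m.
  rewrite (grid_joinN gridP) (grid_joing gridP) (maxn_idPl rq).
  by rewrite max_r // ltW // Kr.
- move=> i m c; have -> : p0 = u 0%N by rewrite /u q0.
  split; first exact: ult.
  by case: c => [j|b] /=; [apply: gule|apply/ltW/Kr].
- by move=> m m' [i|b] mm' //=; apply: gule.
- move=> m m' [i|b] [j|b'] //=; first by rewrite !ord1 ltxx.
    by move=> _; apply: Kr.
  move=> bb'.
  apply: (grid_ideal_lt gridP (Jid b') (Jinf b') (Jr _ _ _) (nJr b')).
  by move: bb'; rewrite !ltNge.
- by move=> m m' [i|b] [j|b'] //=; rewrite !ord1 ltxx.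
Qed.
End Minimality.

(** * Strict order on sums, and subsets of chains *)

Section OsumLt.
Context d d' (X : orderType d) (Y : orderType d').

Lemma osum_lt_inl (x y : X) : (inl x < inl y :> osum X Y) = (x < y).
Proof. by rewrite !ltNge. Qed.

Lemma osum_lt_inr (x y : Y) : (inr x < inr y :> osum X Y) = (x < y).
Proof. by rewrite !ltNge. Qed.

End OsumLt.

(** A second name for [subposet], to carry the total order inherited from a chain. *)
Definition subchain d (A : orderType d) (S : set A) : Type := subposet S.

HB.instance Definition _ d (A : orderType d) (S : set A) :=
  SubChoice.on (subchain S).
HB.instance Definition _ d (A : orderType d) (S : set A) :=
  [SubChoice_isSubOrder of subchain S by <: with d].

(** * Jumps of a chain of ideals *)

Section IdealChains.
Context d (A : orderType d) d' (P : bJoinSemilatticeType d').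
Variable Phi : set A -> set P.
Hypothesis Phim : forall I I', initial_segment I -> initial_segment I' ->
  (Phi I `<=` Phi I') <-> (I `<=` I').

Lemma initial_segment_le (a : A) : initial_segment [set x | x <= a].
Proof. by move=> x y xy; apply: le_trans. Qed.

Lemma initial_segment_lt (a : A) : initial_segment [set x | x < a].
Proof. by move=> x y xy; apply: le_lt_trans. Qed.

Lemma Phi_jump : exists r : A -> P,
  forall a, Phi [set x | x <= a] (r a) /\ ~ Phi [set x | x < a] (r a).
Proof.
suff /choice[r rP] : forall a, exists x,
    Phi [set x | x <= a] x /\ ~ Phi [set x | x < a] x by exists r.
move=> a; apply: contrapT => nr.
suff : [set x | x <= a] `<=` [set x | x < a].
  by move=> /(_ a (lexx a)) /=; rewrite ltxx.
apply/Phim; [exact: initial_segment_le|exact: initial_segment_lt|].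
by move=> x xa; apply: contrapT => nx; apply: nr; exists x.
Qed.

Lemma Phi_le_lt (a b : A) : 
  a < b -> Phi [set x | x <= a] `<=` Phi [set x | x < b].
Proof.
move=> ab; apply/Phim; [exact: initial_segment_le|exact: initial_segment_lt|].
by move=> x /= /le_lt_trans; apply.
Qed.

(** The jump elements [r a], for [a] in [I], are pairwise distinct and all lie in [Phi I]. *)
Lemma Phi_infinite (I : set A) :
  initial_segment I -> infinite_set I -> infinite_set (Phi I).
Proof.
move=> hI Iinf PhiIfin; apply: Iinf; have [r rP] := Phi_jump.
apply: (@sub_finite_set _ _ (r @^-1` Phi I)).
  move=> a Ia; have [ra _] := rP a.
  apply: (Phim _ _).2 ra => //; first exact: initial_segment_le.
  by move=> x /= /hI; apply.
apply: finite_preimage => // a b _ _ ab.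
case: (ltgtP a b) => // [lt|lt].
  by have := Phi_le_lt lt (rP a).1; rewrite ab => /(rP b).2.
by have := Phi_le_lt lt (rP b).1; rewrite -ab => /(rP a).2.
Qed.

End IdealChains.

(** * Shifts of a chain and initial segments of type omega *)

(** Any [y] outside the final segment is strictly below all of it, hence below the whole image of
    the embedding. *)
Lemma embeds_proper_shift d (A : orderType d) :
  embeds_in_proper_final_segment A ->
  exists (g : A -> A) (y : A), {mono g : a b / a <= b} /\ forall a, y < g a.
Proof.
move=> [F [hF FT [f fm]]].
have [y nFy] : exists y, ~ F y.
  apply: contrapT => nF; move/eqP: FT; apply; apply/seteqP; split=> // x _.
  by apply: contrapT => nFx; apply: nF; exists x.
exists (val \o f), y; split=> [a b|a]; first exact: fm.
rewrite ltNge; apply/negP => /hF; move/(_ (set_mem (valP (f a)))); exact: nFy.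
Qed.

(** Outside the set [F] of elements above all [x k], each element has finitely many predecessors,
    and counting them embeds that part in [nat]; [x] itself gives the converse embedding. *)
Lemma starts_with_omega_subchain d (A : orderType d) (x : nat -> A) :
  {homo x : k l / (k < l)%N >-> k < l} ->
  (forall k, finite_set [set a | a < x k]) ->
  starts_with_omega A (subchain [set a | forall k, x k < a]).
Proof.
move=> xlt xfin; set F := [set a | forall k, x k < a].
have nF a : ~ F a -> finite_set [set b | b < a].
  move=> Fa; have [k ak] : exists k, a <= x k.
    apply: contrapT => nk; apply: Fa => k; rewrite ltNge.
    by apply/negP => ak; apply: nk; exists k.
  by apply: sub_finite_set (xfin k) => b /= /lt_le_trans; apply.
split.
  exists (fun a => if pselect (F a) is left h
                   then inr (to_subposet h : subchain F)
                   else inl #|` fset_set [set b | b < a]|).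
  apply: le_mono => a b ab; case: pselect => Fa; case: pselect => Fb.
  - by rewrite osum_lt_inr.
  - by case: Fb => k; apply: lt_trans (Fa k) ab.
  - by [].
  - rewrite osum_lt_inl ltEnat; apply: fproper_ltn_card.
    rewrite fproperE; apply/andP; split.
      apply/fsubsetP => c.
      rewrite !in_fset_set ?inE; try exact: nF.
      by move=> /lt_trans; apply.
    apply/fsubsetPn; exists a; rewrite in_fset_set; try exact: nF.
      exact/mem_set.
    by apply/negP => /set_mem /=; rewrite ltxx.
exists (fun u : osum nat (subchain F) =>
  match u with inl k => x k | inr a => val a end).
apply: le_mono => -[k|a] [l|b].
- by rewrite osum_lt_inl ltEnat; apply: xlt.
- by move=> _; have := set_mem (valP b); apply.
- by [].
- by rewrite osum_lt_inr.
Qed.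

Lemma infinite_set_lt d (A : orderType d) (a : A) :
  ~ (exists m : A, is_least m) -> infinite_set [set x | x < a].
Proof.
move=> nl fin; apply: nl; have [b bP] := finite_set_lower_bound a fin.
exists (Order.min b a) => x; rewrite ge_min; case: (ltP x a) => [/bP -> //|_].
by rewrite orbT.
Qed.

(** * The three cases of the definition of [P_alpha] *)

Section Cases.
Context d (P : bJoinSemilatticeType d) d' (G : orderType d').
Variables (N : P -> nat) (g : P -> G).
Hypothesis gridP : grid_coordinates N g.

Lemma join_embeds_osum_ord n dB (B : orderType dB)
    (S : join_subset (nat *p B)%type) :
  (forall m, finite_set [set c | join_carrier S (m, c)]) ->
  B -> ~ (exists m : B, is_least m) -> in_J (osum 'I_n B) P ->
  join_embeds (osum 'I_n.+1 (subposet S)) P.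
Proof.
move=> Sfin b0 nl /in_JP[Phi [PhiI Phim]].
pose I k : set (osum 'I_n B) :=
  [set u : osum 'I_n B | if u is inl j then (nat_of_ord j < k)%N else false].
have hI k : initial_segment (I k).
  by move=> [i|a] [j|b] //= ij jk; apply: leq_ltn_trans jk.
have [_ [x0 Ix0] _] := PhiI _ (hI 0%N).
(* The relation is guarded by [k < n] and by membership so that a successor always exists; where the
   guard fails, [x] is repeated. *)
have [|p [p0 pP]] := @dependent_choice P (fun k x y =>
    (k < n)%N -> Phi (I k) x -> x < y /\ Phi (I k.+1) y) x0.
  move=> k x; have [kn|nk] := ltnP k n; last first.
    by exists x.
  have [Ix|] := pselect (Phi (I k) x); last by exists x.
  have [r [Ir nIr]] : exists r, Phi (I k.+1) r /\ ~ Phi (I k) r.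
    apply: contrapT => nr.
    suff Ik : I k.+1 `<=` I k.
      by have := Ik (inl (Ordinal kn)) (ltnSn k); rewrite /I /= ltnn.
    apply/Phim => // y Iy; apply: contrapT => nIy; apply: nr; by exists y.
  have [_ _ Iu] := PhiI _ (hI k.+1).
  have Ix' : Phi (I k.+1) x.
    by apply: (Phim _ _ (hI k) (hI k.+1)).2 Ix => -[j|//] /= /ltnW.
  have [z [Iz xz rz]] := Iu _ _ Ix' Ir.
  exists z => _ _; split=> //; rewrite lt_neqAle xz andbT.
  (* If [z] were [x], then [r <= x] would put [r] in [Phi (I k)]. *)
  apply/eqP => xz'; apply: nIr; have [Id _ _] := PhiI _ (hI k).
  by apply: Id rz _; rewrite -xz'.
have Ip k : (k <= n)%N -> Phi (I k) (p k).
  elim: k => [|k IH] kn; first by rewrite p0.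
  by have [] := pP k kn (IH (ltnW kn)).
have plt k l : (k < l)%N -> (l <= n)%N -> p k < p l.
  elim: l => // l IH; rewrite ltnS leq_eqVlt => /orP[/eqP ->|kl] ln.
    by have [] := pP l ln (Ip _ (ltnW ln)).
  apply: lt_trans (IH kl (ltnW ln)) _.
  by have [] := pP l ln (Ip _ (ltnW ln)).
have [r rP] := Phi_jump Phim.
have hJ c := @initial_segment_lt _ (osum 'I_n B) c.
(* The predecessors of [c] in [B] are already infinitely many, as [B] has no least element. *)
have Jinf c : infinite_set (Phi [set u : osum 'I_n B | u < inr c]).
  apply: (Phi_infinite Phim (hJ _)) => fin; apply: (@infinite_set_lt _ _ c nl).
  apply: sub_finite_set (finite_preimage _ fin); last first.
    by move=> x y _ _; exact: inr_inj.
  by move=> x /=; rewrite osum_lt_inr.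
apply: (@join_embeds_slabs _ _ _ _ _ _ gridP n _ _ S (fun i => p i)
  (fun c => Phi [set u : osum 'I_n B | u < inr c]) (fun c => r (inr c))) => //.
- by apply: le_mono => i j ij; apply: plt => //; rewrite -ltnS.
- by move=> c; apply: PhiI.
- by move=> c; apply: (rP _).2.
- move=> c c' cc'; apply: (Phi_le_lt Phim _ (rP _).1).
  by rewrite osum_lt_inr.
- move=> c; apply: (Phim _ _ (hI n) (hJ _)).2 (Ip n (leqnn n)).
  by case.
move=> R /(finite_set_lower_bound b0)[b bP].
exists (Phi [set u : osum 'I_n B | u < inr b]) => [|c /bP bc].
  exact: Jinf.
apply/Phim; [exact: hJ..|] => u /= /lt_le_trans; apply; exact: bc.
Qed.

(** For the initial copy [W] of omega, [Phi W] is an infinite ideal inside [Phi] of the elements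
    below any [inr c], so one [K] serves all rows. *)
Lemma join_embeds_omega dB (B : orderType dB)
    (S : join_subset (nat *p osum 'I_1 B)%type) :
  (forall m, finite_set [set c | join_carrier S (m, c)]) ->
  in_J (osum nat B) P -> join_embeds (osum 'I_1 (subposet S)) P.
Proof.
move=> Sfin /in_JP[Phi [PhiI Phim]]; have [r rP] := Phi_jump Phim.
pose W : set (osum nat B) := range inl.
have hW : initial_segment W.
  by move=> [i|a] [j|b] // _ [k _ //] _; exists i.
have hJ c := @initial_segment_lt _ (osum nat B) c.
apply: (@join_embeds_staircase _ _ _ _ _ _ gridP _ _ S (Phi W)
  (fun c => Phi [set u : osum nat B | u < inr c]) (fun c => r (inr c))) => //.
- by move=> c; apply: PhiI.
- by move=> c; apply: (rP _).2.
- move=> c c' cc'; apply: (Phi_le_lt Phim _ (rP _).1).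
  by rewrite osum_lt_inr.
- exact: PhiI.
- apply: (Phi_infinite Phim hW) => fin; apply: infinite_nat.
  apply: sub_finite_set (finite_preimage _ fin); last first.
    by move=> x y _ _; exact: inl_inj.
  by move=> k _; exists k.
- by move=> c; apply/Phim => // _ [k _ <-].
Qed.

Lemma join_embeds_shift dA (A : orderType dA)
    (S : join_subset (nat *p A)%type) :
  (forall m, finite_set [set c | join_carrier S (m, c)]) ->
  embeds_in_proper_final_segment A ->
  (forall dB (B : orderType dB), ~ starts_with_omega A B) ->
  in_J A P -> join_embeds (osum 'I_1 (subposet S)) P.
Proof.
move=> Sfin /embeds_proper_shift[h [y [hm yh]]] nomega /in_JP[Phi [PhiI Phim]].
have hJ := @initial_segment_lt _ A.
have xlt : {homo (fun k => iter k h y) : k l / (k < l)%N >-> k < l}.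
  apply: homo_ltn (@lt_trans _ A) _ => k.
  by elim: k => [|k IH]; [exact: yh|rewrite /= (leW_mono hm)].
(* If all these ideals were finite, so would be the segments below [iter k h y], and [A] would start
   with omega. *)
have [k xk] : exists k, infinite_set (Phi [set a | a < iter k h y]).
  apply: contrapT => nk; apply: (nomega _ _ (starts_with_omega_subchain xlt _)).
  move=> k; apply: contrapT => kinf; apply: nk; exists k.
  exact: (Phi_infinite Phim (hJ _)).
(* Apply [iter k h] to [y < h a]: the image of [iter k.+1 h] lies above the segment that gives
   [K]. *)
have xh a : iter k h y < iter k.+1 h a.
  rewrite iterSr; elim: (k) => [|l IH]; first exact: yh.
  by rewrite /= (leW_mono hm).
have hkm : {mono iter k.+1 h : a b / a < b}.
  by move=> a b; elim: (k.+1) => // l IH; rewrite /= (leW_mono hm).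
have [r rP] := Phi_jump Phim.
have KJ a : Phi [set b | b < iter k h y] `<=` Phi [set b | b < iter k.+1 h a].
  by apply/Phim; [exact: hJ..|] => b /lt_trans; apply; exact: xh.
have [_ [p0 Kp0] _] := PhiI _ (hJ (iter k h y)).
apply: (@join_embeds_slabs _ _ _ _ _ _ gridP 0 _ _ S (fun=> p0)
  (fun a => Phi [set b | b < iter k.+1 h a])
  (fun a => r (iter k.+1 h a))) => //.
- by move=> i j; rewrite !ord1 !lexx.
- by move=> a; apply: PhiI.
- by move=> a; apply: sub_infinite_set xk; apply: KJ.
- by move=> a; apply: (rP _).2.
- by move=> a b ab; apply: (Phi_le_lt Phim _ (rP _).1); rewrite hkm.
- by move=> a; apply: KJ.
- by move=> R _; exists (Phi [set b | b < iter k h y]) => // a _; apply: KJ.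
Qed.

End Cases.

(** * Reduction of minimality to the three cases *)

Lemma grid_join_embeds n d d' (P : bJoinSemilatticeType d) (G : orderType d')
    (S : join_subset (nat *p G)%type) :
  (forall k, finite_set [set a | join_carrier S (k, a)]) ->
  join_embeds P (osum 'I_n (subposet S)) ->
  exists (N : P -> nat) (g : P -> osum 'I_n G), grid_coordinates N g.
Proof.
move=> /(grid_osum n) gP [f fm fj]; have fP := grid_embeds fm fj gP.
by do 2!eexists; exact: fP.
Qed.

(** A least element adjoined by [add_bottom] becomes the top of the finite chain; if none was
    adjoined, [ord_max] is left out. *)
Lemma join_embeds_osum_add_bottom n d (L : joinSemilatticeType d) :
  join_embeds (osum 'I_n (add_bottom L)) (osum 'I_n.+1 L).
Proof.
pose f (u : osum 'I_n (add_bottom L)) : osum 'I_n.+1 L := match u with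
  | inl i => inl (widen_ord (leqnSn n) i)
  | inr v => match val v with inl _ => inl ord_max | inr x => inr x end end.
have fr u : f (inr u) = if val u is inr x then inr x else inl ord_max by [].
have fm : {mono f : x y / x <= y}.
  move=> [i|u] [j|v] //.
  - rewrite fr; case: (val v) => [k|x] //.
    by rewrite [LHS]/Order.le /= leEord /= ltnW ?ltn_ord.
  - rewrite fr; case: (val u) => [k|x] //.
    by rewrite [LHS]/Order.le /= leEord /= leqNgt ltn_ord.
  - rewrite !fr [RHS]/(val u <= val v); case: (val u) (val v) => [k|x] [l|y] //.
    by rewrite !ord1 [LHS]/Order.le /= [RHS]/Order.le /= !lexx.
have fle x y : x <= y -> f (Order.join x y) = Order.join (f x) (f y).
  by move=> xy; rewrite (join_r xy) join_r // fm.
exists f => // -[i|u] [j|v].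
- have /orP[ij|ij] := le_total i j; first exact: fle.
  by rewrite joinC [RHS]joinC; apply: fle.
- exact: fle.
- by rewrite joinC [RHS]joinC; apply: fle.
rewrite [f (inr u)]fr [f (inr v)]fr.
have -> : Order.join (inr u : osum 'I_n (add_bottom L)) (inr v) =
  inr (Order.join u v) by [].
rewrite fr val_join; case: (val u) (val v) => [k|x] [l|y] //.
by rewrite joinxx.
Qed.

Theorem mainTheorem6 (d : Order.disp_t) (A : orderType d)
    (hcount : countable [set: A]%classic) (hinf : infinite_set [set: A]%classic)
    (d' : Order.disp_t) (M : bJoinSemilatticeType d') (hM : P_alpha A M) :
  minimal_in_J A M.
Proof.
case: hM => [n d1 A' S _ [f [h fK hK] fm] nl SP|
  d1 A' S _ [Af fA] SP|S Ash nom SP].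
- have hm : {mono h : x y / x <= y} by move=> x y; rewrite -fm !hK.
  split; first by apply: in_J_embeds (in_J_osum n SP); exists f.
  move=> d2 P JP /join_leP PM; apply/join_leP.
  (* Both [M] and [P] embed in [osum 'I_n.+1 (subposet S)]. This gives coordinates on [P], and it
     suffices to embed that larger semilattice in [P]. *)
  have MT := join_embeds_osum_add_bottom n (subposet S).
  have PT := join_embeds_trans PM MT; apply: join_embeds_trans MT _.
  have Sfin m := (SP.1 m).2; have [[a _] _] := SP.1 0%N.
  have [N [g gP]] := grid_join_embeds Sfin PT.
  apply: (join_embeds_osum_ord gP Sfin a nl); apply: in_J_embeds JP.
  by exists h.
- split; first exact: in_J_embeds Af (in_J_omega SP).
  move=> d2 P JP /join_leP PM; apply/join_leP.
  (* By construction [add_bottom] is a join-subset of [osum 'I_1 (subposet S)], which now plays the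
     role of the larger semilattice. *)
  have MT := join_embeds_sub (JoinSubset (@add_bottom_setP _ (subposet S))).
  have PT := join_embeds_trans PM MT; apply: join_embeds_trans MT _.
  have Sfin m := (SP.1 m).2; have [N [g gP]] := grid_join_embeds Sfin PT.
  exact: (join_embeds_omega gP Sfin (in_J_embeds fA JP)).
split; first exact: in_J_add_bottom SP.
move=> d2 P JP /join_leP PM; apply/join_leP.
have MT := join_embeds_sub (JoinSubset (@add_bottom_setP _ (subposet S))).
have PT := join_embeds_trans PM MT; apply: join_embeds_trans MT _.
have Sfin m := (SP.1 m).2; have [N [g gP]] := grid_join_embeds Sfin PT.
exact: (join_embeds_shift gP Sfin Ash).
Qed.
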